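(* Let $\{(x_i,y_i,d_i): i=1,\dots,N\}$ be a set of monotonic data, i.e. $x_1<\dots<x_N$ and $y_1\le y_2\le\dots\le y_N$, and let the derivative parameters satisfy the necessary monotonicity condition $d_i\ge0$, $i=1,\dots,N$. Let $g$ be the rational cubic spline fractal interpolation function (RCSFIF) associated with these data, with scaling factors $\alpha_n$ and shape parameters $u_n>0$, $v_n>0$ ($n=1,\dots,N-1$). Suppose that for every $n=1,\dots,N-1$ $$0\le\alpha_n\le\min\Big\{a_n,\ \frac{h_nd_n}{d_1(x_N-x_1)},\ \frac{h_nd_{n+1}}{d_N(x_N-x_1)},\ \frac{h_n\Delta_n}{y_N-y_1}\Big\}$$ and $$v_n\ge\max\left\{\frac{u_n\big[d_n-\frac{\alpha_n}{h_n}(x_N-x_1)d_1\big]}{\Delta_n-\frac{\alpha_n}{h_n}(y_N-y_1)},\ \frac{u_n\big[d_{n+1}-\frac{\alpha_n}{h_n}(x_N-x_1)d_N\big]}{\Delta_n-\frac{\alpha_n}{h_n}(y_N-y_1)},\ \frac{u_n\big[d_n+d_{n+1}-\frac{\alpha_n}{h_n}(x_N-x_1)(d_1+d_N)\big]}{\Delta_n-\frac{\alpha_n}{h_n}(y_N-y_1)}\right\}$$ (all denominators being nonzero). Then $g$ is monotone (nondecreasing) on $I=[x_1,x_N]$.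
   Context: Let $N>2$, $x_1<x_2<\dots<x_N$, $I=[x_1,x_N]$, $I_n=[x_n,x_{n+1}]$, $h_n=x_{n+1}-x_n$, $a_n=h_n/(x_N-x_1)$, $\Delta_n=(y_{n+1}-y_n)/h_n$, and let $L_n:I\to I_n$ be the increasing affine map $L_n(x)=a_nx+b_n$ with $L_n(x_1)=x_n$, $L_n(x_N)=x_{n+1}$ ($n=1,\dots,N-1$). Given Hermite data $\{(x_i,y_i,d_i)\}_{i=1}^N\subset\mathbb{R}^3$, scaling factors $\alpha_n$ satisfying the standing assumption $|\alpha_n|\le\kappa a_n$ for some fixed $\kappa\in[0,1)$, and shape parameters $u_n>0$, $v_n>0$, the RCSFIF $g$ is the unique continuous function $g:I\to\mathbb{R}$ satisfying $$g(L_n(x))=\alpha_ng(x)+\frac{P_n(\theta)}{Q_n(\theta)},\qquad \theta=\frac{x-x_1}{x_N-x_1},\quad x\in I,\ n=1,\dots,N-1,$$ where $Q_n(\theta)=u_n+v_n\theta(1-\theta)$ and $$\begin{aligned}P_n(\theta)={}&u_n(y_n-\alpha_ny_1)(1-\theta)^3\\&+\{(3u_n+v_n)(y_n-\alpha_ny_1)+u_nh_nd_n-\alpha_nu_n(x_N-x_1)d_1\}(1-\theta)^2\theta\\&+\{(3u_n+v_n)(y_{n+1}-\alpha_ny_N)-u_nh_nd_{n+1}+\alpha_nu_n(x_N-x_1)d_N\}(1-\theta)\theta^2\\&+u_n(y_{n+1}-\alpha_ny_N)\theta^3 .\end{aligned}$$ It belongs to $\mathcal{C}^1(I)$ and satisfies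 $g(x_i)=y_i$, $g^{(1)}(x_i)=d_i$ for all $i$. *)

(* Defs.v *)
From HB Require Import structures.
From mathcomp Require Import all_boot all_order all_algebra.
From mathcomp Require Import all_classical all_reals all_analysis.

Set Implicit Arguments.
Unset Strict Implicit.
Unset Printing Implicit Defensive.

Import Order.TTheory GRing.Theory Num.Theory.
Import numFieldNormedType.Exports.
Local Open Scope classical_set_scope.
Local Open Scope ring_scope.

(* Data are indexed as x_1, ..., x_N (knots) and alpha_1, ..., alpha_{N-1}
   (subintervals): families are functions on nat of which only these indices
   are meaningful. *)

Definition knot_step (R : realType) (x : nat -> R) (n : nat) : R :=
  x n.+1 - x n.

Definition contraction_ratio (R : realType) (N : nat) (x : nat -> R)
    (n : nat) : R :=
  knot_step x n / (x N - x 1%N).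

Definition secant_slope (R : realType) (x y : nat -> R) (n : nat) : R :=
  (y n.+1 - y n) / knot_step x n.

(* The affine map a_n t + b_n onto [x_n, x_{n+1}]; the value of b_n is forced
   by affine_map_left, and affine_map_right then holds. *)
Definition affine_map (R : realType) (N : nat) (x : nat -> R) (n : nat)
    (t : R) : R :=
  contraction_ratio N x n * t + (x n - contraction_ratio N x n * x 1%N).

Lemma affine_map_left (R : realType) (N : nat) (x : nat -> R) (n : nat) :
  affine_map N x n (x 1%N) = x n.
Proof. by rewrite /affine_map addrC subrK. Qed.

Lemma affine_map_right (R : realType) (N : nat) (x : nat -> R) (n : nat) :
  x 1%N < x N -> affine_map N x n (x N) = x n.+1.
Proof.
move=> x1N; rewrite /affine_map addrCA -mulrBr /contraction_ratio divfK.
  by rewrite addrC subrK.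
by rewrite subr_eq0 gt_eqF.
Qed.

Definition rcsfif_den (R : realType) (u v : nat -> R) (n : nat)
    (theta : R) : R :=
  u n + v n * theta * (1 - theta).

Definition rcsfif_num (R : realType) (N : nat) (x y d alpha u v : nat -> R)
    (n : nat) (theta : R) : R :=
  u n * (y n - alpha n * y 1%N) * (1 - theta) ^+ 3
  + ((3 * u n + v n) * (y n - alpha n * y 1%N) + u n * knot_step x n * d n
     - alpha n * u n * (x N - x 1%N) * d 1%N) * (1 - theta) ^+ 2 * theta
  + ((3 * u n + v n) * (y n.+1 - alpha n * y N)
     - u n * knot_step x n * d n.+1
     + alpha n * u n * (x N - x 1%N) * d N) * (1 - theta) * theta ^+ 2
  + u n * (y n.+1 - alpha n * y N) * theta ^+ 3.

(* g is the rational cubic spline fractal interpolation function of the data.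
   Only the restriction of g to I = [x_1, x_N] is constrained; interpolation
   and smoothness are consequences and are not part of the definition. *)
Definition is_rcsfif (R : realType) (N : nat) (x y d alpha u v : nat -> R)
    (g : R -> R) : Prop :=
  {within `[x 1%N, x N]%classic, continuous g} /\
  forall (n : nat) (t : R), (1 <= n < N)%N -> t \in `[x 1%N, x N] ->
    let theta := (t - x 1%N) / (x N - x 1%N) in
    g (affine_map N x n t) =
      alpha n * g t
      + rcsfif_num N x y d alpha u v n theta / rcsfif_den u v n theta.

(* Main.v *)
Require Import Defs.
From HB Require Import structures.
From mathcomp Require Import all_boot all_order all_algebra.
From mathcomp Require Import all_classical all_reals all_analysis.
From mathcomp Require Import ring lra zify.

Set Implicit Arguments.
Unset Strict Implicit.
Unset Printing Implicit Defensive.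

Import Order.TTheory GRing.Theory Num.Theory.
Import numFieldNormedType.Exports.
Local Open Scope ring_scope.

(* The drop e = sup {g s - g t | s <= t} contracts under the functional
   equation: the rational parts P_n/Q_n are nondecreasing, so a drop of g is at
   most kappa * e, hence e <= kappa * e and e = 0.
   Each P_n/Q_n is a rational Bezier cubic with positive weights (u, k, k, u),
   k = 3 u + v, and the bound on v_n says that its control values increase. *)

(** * Monotonicity of a single rational cubic piece *)

Lemma rational_cubic_nondecr (R : realFieldType) (u v y0 y1 d0 d1 : R) :
  0 < u -> 0 < v -> 0 <= d0 -> 0 <= d1 -> u * (d0 + d1) <= v * (y1 - y0) ->
  {in `[0, 1] &, {homo (fun t =>
     (u * y0 * (1 - t) ^+ 3
      + ((3 * u + v) * y0 + u * d0) * (1 - t) ^+ 2 * t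
      + ((3 * u + v) * y1 - u * d1) * (1 - t) * t ^+ 2
      + u * y1 * t ^+ 3) / (u + v * t * (1 - t))) : s t / s <= t}}.
Proof.
move=> u0 v0 d0_ge0 d1_ge0 uv s t; rewrite !in_itv /=.
move=> /andP[s0 s1] /andP[t0 t1] st.
have den_gt0 z : 0 <= z -> z <= 1 -> 0 < u + v * z * (1 - z).
  move=> z0 z1; rewrite ltr_wpDr// mulr_ge0 ?subr_ge0//.
  by rewrite mulr_ge0// ltW.
rewrite ler_pdivrMr ?den_gt0// [leRHS]mulrAC ler_pdivlMr ?den_gt0// -subr_ge0.
have ud0 : 0 <= u * d0 by rewrite mulr_ge0// ltW.
have ud1 : 0 <= u * d1 by rewrite mulr_ge0// ltW.
have y01 : 0 <= y1 - y0 by rewrite -(pmulr_rge0 _ v0) (le_trans _ uv)// mulrDr addr_ge0.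
have uy : 0 <= u * (y1 - y0) by rewrite mulr_ge0// ltW.
set k := 3 * u + v.
have k0 : 0 <= k by rewrite /k; lra.
set A := u * d0; set B := k * (y1 - y0) - u * d1; set C := u * (y1 - y0).
(* [B - A] is [3 * C] plus the slack in [uv]; this is where the bound on the shape parameter
   enters. *)
have AB : A <= B by rewrite /A /B /k; lra.
have AkC : A <= k * (y1 - y0) by rewrite /A /k; lra.
pose w := 1 - s; pose W := 1 - t.
have w0 : 0 <= w by rewrite subr_ge0.
have W0 : 0 <= W by rewrite subr_ge0.
(* [t * w - s * W] equals [t - s]. This compares the odds s / (1 - s) and t / (1 - t) without
   dividing by zero at the endpoint 1. *)
have cross : s * W <= t * w by rewrite /w /W; lra.
have crossX n : 0 <= (t * w) ^+ n - (s * W) ^+ n.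
  by rewrite subr_ge0 lerXn2r// ?nnegrE ?mulr_ge0.
have B0 : 0 <= B by exact: le_trans AB.
have u_ge0 := ltW u0.
(* Writing [N / D] for the fraction minus [y0] in the Bernstein basis of degree
   3, [N t * D s - N s * D t] is a combination of the 2x2 minors of the
   coefficients (0, A, B, C) of N and (u, k, k, u) of D, all nonnegative. *)
have : 0 <= u * A * ((w * W) ^+ 2 * ((t * w) ^+ 1 - (s * W) ^+ 1))
    + u * B * (w * W * ((t * w) ^+ 2 - (s * W) ^+ 2))
    + u * C * ((t * w) ^+ 3 - (s * W) ^+ 3)
    + k * (B - A) * (w * W * (s * t) * ((t * w) ^+ 1 - (s * W) ^+ 1))
    + u * (k * (y1 - y0) - A) * (s * t * ((t * w) ^+ 2 - (s * W) ^+ 2))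
    + u * (u * d1) * ((s * t) ^+ 2 * ((t * w) ^+ 1 - (s * W) ^+ 1)).
  rewrite !addr_ge0//; do ![rewrite mulr_ge0 ?exprn_ge0 ?mulr_ge0 ?subr_ge0//];
  by rewrite -subr_ge0.
by congr (0 <= _); rewrite /A /B /C /k /w /W; ring.
Qed.

(** * Knots, cells and their affine maps *)

Lemma data_nondecr (R : numDomainType) (N : nat) (y : nat -> R) :
  (forall i, (1 <= i < N)%N -> y i <= y i.+1) ->
  forall i j, (1 <= i)%N -> (i <= j <= N)%N -> y i <= y j.
Proof.
move=> y_nd i j i1; elim: j => [|j IH] /andP[ij jN]; first by lia.
move: ij; rewrite leq_eqVlt => /orP[/eqP->//|ij].
by apply: (le_trans (IH _) (y_nd _ _)); lia.
Qed.

Section Knots.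
Variables (R : realType) (N : nat) (x : nat -> R).
Hypothesis x_incr : forall i : nat, (1 <= i < N)%N -> x i < x i.+1.

Lemma knot_le i j : (1 <= i)%N -> (i <= j <= N)%N -> x i <= x j.
Proof. by apply: data_nondecr => k /x_incr/ltW. Qed.

Lemma knot_first_lt_last : (1 < N)%N -> x 1%N < x N.
Proof.
move=> N1; apply: (lt_le_trans (@x_incr 1%N _)); first by lia.
by apply: knot_le; lia.
Qed.

Lemma knot_interval t : (1 < N)%N -> t \in `[x 1%N, x N] ->
  exists2 n, (1 <= n < N)%N & x n <= t <= x n.+1.
Proof.
move=> N1; rewrite in_itv /= => /andP[t1 tN].
suff loc m : (1 < m <= N)%N -> t <= x m ->
    exists2 n, (1 <= n < m)%N & x n <= t <= x n.+1.
  by apply: loc => //; lia.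
elim: m => [|m IH] /andP[m1 mN] tm; first by lia.
have [tm'|/ltW mt] := lerP t (x m).
  have [m2|m_le1] := ltnP 1 m.
    by have [||n n_m n_t] := IH => //; [lia|exists n => //; lia].
  by have m_1 : m = 1%N by [lia]; subst m; exists 1%N; rewrite ?t1.
by exists m; [lia|rewrite mt].
Qed.

Lemma contraction_ratio_gt0 n : (1 <= n < N)%N -> 0 < contraction_ratio N x n.
Proof.
move=> nN; rewrite divr_gt0// subr_gt0; first exact: x_incr.
by apply: knot_first_lt_last; lia.
Qed.

(** Distinct cells overlap at most in a knot, so their lengths add up to no more than the length of
    the whole interval. *)
Lemma contraction_ratioD_le1 m n : (1 <= m)%N -> (m < n < N)%N ->
  contraction_ratio N x m + contraction_ratio N x n <= 1.
Proof.
move=> m1 mnN; have x1N : x 1%N < x N by apply: knot_first_lt_last; lia.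
rewrite -mulrDl ler_pdivrMr ?subr_gt0// mul1r /knot_step.
have : x 1%N <= x m by apply: knot_le; lia.
have : x m.+1 <= x n by apply: knot_le; lia.
have : x n.+1 <= x N by apply: knot_le; lia.
lra.
Qed.

Lemma contraction_ratio_le1 n : (1 <= n < N)%N -> contraction_ratio N x n <= 1.
Proof.
move=> nN; have x1N : x 1%N < x N by apply: knot_first_lt_last; lia.
rewrite ler_pdivrMr ?subr_gt0// mul1r lerB// knot_le//; lia.
Qed.

Lemma affine_map_le n s t : (1 <= n < N)%N ->
  (affine_map N x n s <= affine_map N x n t) = (s <= t).
Proof. by move=> nN; rewrite lerD2r ler_pM2l// contraction_ratio_gt0. Qed.

Lemma affine_map_surj n t : (1 <= n < N)%N -> x n <= t <= x n.+1 ->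
  exists2 s, s \in `[x 1%N, x N] & t = affine_map N x n s.
Proof.
move=> nN /andP[nt tn]; have a0 := contraction_ratio_gt0 nN.
have x1N : x 1%N < x N by apply: knot_first_lt_last; lia.
pose s := x 1%N + (t - x n) / contraction_ratio N x n.
have st : affine_map N x n s = t.
  by rewrite /affine_map /s mulrDr mulrCA divff ?gt_eqF//; lra.
exists s => //; rewrite in_itv /= -(affine_map_le _ _ nN) -[s <= _](affine_map_le _ _ nN).
by rewrite affine_map_left affine_map_right// st nt.
Qed.

(* If [e] bounds every drop of [g], self-similarity bounds a drop inside one
   cell by [alpha n * e]; a drop across cells m < n splits at the knots into
   drops inside these two cells, and a_m + a_n <= 1. *)
Lemma self_similar_nondecr (alpha : nat -> R) (kappa : R)
    (r : nat -> R -> R) (g : R -> R) :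
  (1 < N)%N -> 0 <= kappa < 1 ->
  (forall n, (1 <= n < N)%N ->
     0 <= alpha n <= kappa * contraction_ratio N x n) ->
  {within `[x 1%N, x N], continuous g}%classic ->
  (forall n, (1 <= n < N)%N -> {in `[x 1%N, x N], forall t,
     g (affine_map N x n t) = alpha n * g t + r n t}) ->
  (forall n, (1 <= n < N)%N ->
     {in `[x 1%N, x N] &, {homo r n : s t / s <= t}}) ->
  (forall n, (1 <= n < N)%N -> g (x n) <= g (x n.+1)) ->
  {in `[x 1%N, x N] &, {homo g : s t / s <= t}}.
Proof.
move=> N1 /andP[kappa0 kappa1] alphaP g_cont gE r_nd g_knot.
have x1N := knot_first_lt_last N1.
have cell e n s t : (forall s t, s \in `[x 1%N, x N] -> t \in `[x 1%N, x N] ->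
      s <= t -> g s - g t <= e) -> (1 <= n < N)%N ->
    x n <= s -> s <= t -> t <= x n.+1 ->
    g s - g t <= kappa * contraction_ratio N x n * e.
  move=> drop nN ns st tn.
  have [|s' s'I s'E] := @affine_map_surj n s nN; first by rewrite ns (le_trans st).
  have [|t' t'I t'E] := @affine_map_surj n t nN; first by rewrite (le_trans ns st).
  have st' : s' <= t' by rewrite -(affine_map_le _ _ nN) -s'E -t'E.
  have /andP[alpha0 alpha_le] := alphaP _ nN.
  have e0 : 0 <= e by rewrite (le_trans _ (drop _ _ s'I s'I (lexx _)))// subrr.
  rewrite s'E t'E !gE//; have := r_nd _ nN _ _ s'I t'I st'.
  have := ler_wpM2l alpha0 (drop _ _ s'I t'I st').
  have := ler_wpM2r e0 alpha_le; lra.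
have shrink e : (forall s t, s \in `[x 1%N, x N] -> t \in `[x 1%N, x N] ->
      s <= t -> g s - g t <= e) ->
    forall s t, s \in `[x 1%N, x N] -> t \in `[x 1%N, x N] ->
      s <= t -> g s - g t <= kappa * e.
  move=> drop s t sI tI st.
  have e0 : 0 <= e by rewrite (le_trans _ (drop _ _ sI sI (lexx _)))// subrr.
  have [m mN /andP[ms sm]] := knot_interval N1 sI.
  have [tm|/ltW mt] := lerP t (x m.+1).
    apply: (le_trans (cell _ _ _ _ drop mN ms st tm)).
    by rewrite ler_wpM2r// ler_piMr// contraction_ratio_le1.
  have [n nN /andP[nt tn]] := knot_interval N1 tI.
  have /andP[m_ge1 m_ltN] := mN; have /andP[n_ge1 n_ltN] := nN.
  (* If n <= m, then [t <= x n.+1 <= x m.+1], so [t] is still in the cell of [s] and the one-cell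
     bound applies. *)
  have [mn|nm] := ltnP m n; last first.
    have tm : t <= x m.+1 by rewrite (le_trans tn)// knot_le// ltnS nm.
    apply: (le_trans (cell _ _ _ _ drop mN ms st tm)).
    by rewrite ler_wpM2r// ler_piMr// contraction_ratio_le1.
  have drop_m := cell _ _ _ _ drop mN ms sm (lexx _).
  have drop_n := cell _ _ _ _ drop nN (lexx _) nt tn.
  (* The stretch between the two cells adds nothing to the drop, because [g] is nondecreasing along
     the knots. *)
  have g_mn : g (x m.+1) <= g (x n).
    by apply: (data_nondecr (N := N) (y := g \o x)); rewrite ?mn ?(ltnW n_ltN).
  have : (contraction_ratio N x m + contraction_ratio N x n) * (kappa * e)
         <= kappa * e.
    by rewrite ler_piMl ?mulr_ge0// contraction_ratioD_le1// mn.
  lra.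
(* The oscillation of [g], finite by compactness, is a first bound on all drops. Iterating [shrink]
   from it replaces the supremum argument: the bounds form a geometric sequence tending to 0. *)
have [c _ c_max] := EVT_max (ltW x1N) g_cont.
have [c' _ c_min] := EVT_min (ltW x1N) g_cont.
have drop_pow k s t : s \in `[x 1%N, x N] -> t \in `[x 1%N, x N] ->
    s <= t -> g s - g t <= kappa ^+ k * (g c - g c').
  elim: k s t => [|k IH]; last by rewrite exprS -mulrA; exact: shrink.
  by move=> s t sI tI _; rewrite mul1r lerB// ?c_max ?c_min.
move=> s t sI tI st; rewrite -subr_le0.
have pow_cvg : (kappa ^+ k * (g c - g c') @[k --> \oo] --> (0 : R))%classic.
  rewrite -(mul0r (g c - g c')); apply: cvgMr_tmp.
  by apply: cvg_expr; rewrite ger0_norm.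
apply: (ler_cvg_to (cvg_cst (g s - g t)) pow_cvg).
by apply: nearW => k; exact: drop_pow.
Qed.

End Knots.

(** * Application to the RCSFIF *)

Theorem theorem4 (R : realType) (N : nat) (x y d alpha u v : nat -> R)
    (kappa : R) (g : R -> R)
  (N_gt2 : (2 < N)%N)
  (x_incr : forall i : nat, (1 <= i < N)%N -> x i < x i.+1)
  (y_nondecr : forall i : nat, (1 <= i < N)%N -> y i <= y i.+1)
  (d_ge0 : forall i : nat, (1 <= i <= N)%N -> 0 <= d i)
  (kappa_range : 0 <= kappa < 1)
  (alpha_kappa : forall n : nat, (1 <= n < N)%N ->
     `|alpha n| <= kappa * contraction_ratio N x n)
  (u_gt0 : forall n : nat, (1 <= n < N)%N -> 0 < u n)
  (v_gt0 : forall n : nat, (1 <= n < N)%N -> 0 < v n)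
  (g_rcsfif : is_rcsfif N x y d alpha u v g)
  (den_d1 : d 1%N * (x N - x 1%N) != 0)
  (den_dN : d N * (x N - x 1%N) != 0)
  (den_y : y N - y 1%N != 0)
  (den_v : forall n : nat, (1 <= n < N)%N ->
     secant_slope x y n - alpha n / knot_step x n * (y N - y 1%N) != 0)
  (alpha_bound : forall n : nat, (1 <= n < N)%N ->
     0 <= alpha n <=
       Num.min (contraction_ratio N x n)
      (Num.min (knot_step x n * d n / (d 1%N * (x N - x 1%N)))
      (Num.min (knot_step x n * d n.+1 / (d N * (x N - x 1%N)))
               (knot_step x n * secant_slope x y n / (y N - y 1%N)))))
  (v_bound : forall n : nat, (1 <= n < N)%N ->
     let D := secant_slope x y n - alpha n / knot_step x n * (y N - y 1%N) in
     Num.max (u n * (d n - alpha n / knot_step x n * (x N - x 1%N) * d 1%N) / D)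
    (Num.max (u n * (d n.+1 - alpha n / knot_step x n * (x N - x 1%N) * d N) / D)
             (u n * (d n + d n.+1
                     - alpha n / knot_step x n * (x N - x 1%N) * (d 1%N + d N)) / D))
     <= v n) :
  {in `[x 1%N, x N] &, {homo g : s t / s <= t}}.
Proof.
have N1 : (1 < N)%N by lia.
have [pN NE] : (1 <= N.-1 < N)%N /\ N.-1.+1 = N by lia.
have d1_ge0 : 0 <= d 1%N by apply: d_ge0; lia.
have dN_ge0 : 0 <= d N by apply: d_ge0; lia.
have y1N_le : y 1%N <= y N by apply: (data_nondecr y_nondecr); lia.
have x1N := knot_first_lt_last x_incr N1.
have ell0 : 0 < x N - x 1%N by rewrite subr_gt0.
have [g_cont gE] := g_rcsfif.
have alphaP n : (1 <= n < N)%N ->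
    0 <= alpha n <= kappa * contraction_ratio N x n.
  move=> nN; have /andP[alpha0 _] := alpha_bound n nN.
  by rewrite alpha0 -(ger0_norm alpha0) alpha_kappa.
have x1I : x 1%N \in `[x 1%N, x N] by rewrite in_itv /= lexx ltW.
have xNI : x N \in `[x 1%N, x N] by rewrite in_itv /= lexx ltW.
(* At theta = 0, and likewise at theta = 1 in [gEr], only one term of the numerator survives and its
   weight [u n] cancels against the denominator. *)
have gEl n : (1 <= n < N)%N ->
    g (x n) = alpha n * g (x 1%N) + (y n - alpha n * y 1%N).
  move=> nN; rewrite -(affine_map_left N x n) gE// subrr mul0r.
  rewrite /rcsfif_num /rcsfif_den.
  by have := gt_eqF (u_gt0 n nN) => /negbT ?; field; rewrite ?mulr0 ?mul0r ?addr0.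
have gEr n : (1 <= n < N)%N ->
    g (x n.+1) = alpha n * g (x N) + (y n.+1 - alpha n * y N).
  move=> nN; rewrite -(affine_map_right n x1N) gE// divff ?gt_eqF//.
  rewrite /rcsfif_num /rcsfif_den.
  by have := gt_eqF (u_gt0 n nN) => /negbT ?; field; rewrite ?subrr ?mulr0 ?addr0.
have alpha_lt1 n : (1 <= n < N)%N -> alpha n < 1.
  move=> nN; have /andP[_ alpha_le] := alphaP n nN.
  have /andP[kappa0 kappa1] := kappa_range.
  apply: (le_lt_trans alpha_le); apply: le_lt_trans kappa1.
  by rewrite ler_piMr// contraction_ratio_le1.
have fixed (a z w : R) : a < 1 -> z = a * z + (w - a * w) -> z = w.
  move=> a1 zE; apply/eqP; rewrite -subr_eq0.
  have /eqP : (1 - a) * (z - w) = 0 by lra.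
  by rewrite mulf_eq0 gt_eqF ?subr_gt0.
(* The first affine map fixes [x 1] and the last one fixes [x N]. There the functional equation is a
   scalar fixed-point equation with factor below 1, which determines the value of [g]. *)
have g1 : g (x 1%N) = y 1%N.
  by apply: (fixed (alpha 1%N)); [exact: alpha_lt1|exact: gEl].
have gN : g (x N) = y N.
  by apply: (fixed (alpha N.-1)); [exact: alpha_lt1|have := gEr _ pN; rewrite NE].
apply: (self_similar_nondecr x_incr N1 kappa_range alphaP g_cont
  (fun n nN t => gE n t nN)) => [n nN|n nN]; last first.
  by rewrite (gEl n)// (gEr n)// g1 gN; have := y_nondecr n nN; lra.
have h0 : 0 < knot_step x n by rewrite subr_gt0 x_incr.
have /andP[alpha0] := alpha_bound n nN.
rewrite !le_min => /and4P[_ alpha_d1 alpha_dN alpha_y].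
(* The monotone data make these denominators nonnegative, so being nonzero they are positive and the
   bounds on [alpha n] can be cleared of fractions. *)
have y1N : 0 < y N - y 1%N.
  by rewrite lt_neqAle eq_sym den_y subr_ge0.
have d1_gt0 : 0 < d 1%N * (x N - x 1%N).
  by rewrite lt_neqAle eq_sym den_d1 mulr_ge0// (ltW ell0).
have dN_gt0 : 0 < d N * (x N - x 1%N).
  by rewrite lt_neqAle eq_sym den_dN mulr_ge0// (ltW ell0).
move: alpha_d1 alpha_dN alpha_y; rewrite !ler_pdivlMr// => alpha_d1 alpha_dN alpha_y.
have hne : knot_step x n != 0 by rewrite gt_eqF.
(* Scaled by h_n, the denominator in the bound on [v n] is the difference of the end values of
   P_n/Q_n. *)
have hD : knot_step x n * (secant_slope x y n - alpha n / knot_step x n * (y N - y 1%N))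
    = y n.+1 - alpha n * y N - (y n - alpha n * y 1%N).
  by rewrite /secant_slope; field.
have D_gt0 : 0 < secant_slope x y n - alpha n / knot_step x n * (y N - y 1%N).
  rewrite lt_neqAle eq_sym den_v// -(pmulr_rge0 _ h0) mulrBr subr_ge0.
  by rewrite mulrA mulrCA divff// mulr1.
have := v_bound n nN; rewrite /= !ge_max => /and3P[_ _].
rewrite ler_pdivrMr// -(ler_pM2l h0) [leRHS]mulrCA hD => vD.
(* The same scaling turns the entry with [d n + d n.+1] into the sum of the end derivatives of
   P_n/Q_n in theta, so that [vD] takes the form required by [rational_cubic_nondecr]. *)
have h_slope : knot_step x n * (u n * (d n + d n.+1
      - alpha n / knot_step x n * (x N - x 1%N) * (d 1%N + d N)))
    = u n * ((knot_step x n * d n - alpha n * (x N - x 1%N) * d 1%N)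
      + (knot_step x n * d n.+1 - alpha n * (x N - x 1%N) * d N)).
  by field.
rewrite h_slope in vD.
(* The bounds on [alpha n] involving [d 1] and [d N] say that these end derivatives are
   nonnegative. *)
have d0 : 0 <= knot_step x n * d n - alpha n * (x N - x 1%N) * d 1%N by lra.
have d1 : 0 <= knot_step x n * d n.+1 - alpha n * (x N - x 1%N) * d N by lra.
have rc := rational_cubic_nondecr (u_gt0 n nN) (v_gt0 n nN) d0 d1 vD.
have unit_itv t : t \in `[x 1%N, x N] -> (t - x 1%N) / (x N - x 1%N) \in `[0, 1].
  rewrite !in_itv /= => /andP[t1 tN].
  by rewrite divr_ge0 ?subr_ge0 ?(ltW x1N)//= ler_pdivrMr// mul1r lerB.
move=> s t sI tI st /=.
have st' : (s - x 1%N) / (x N - x 1%N) <= (t - x 1%N) / (x N - x 1%N).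
  by rewrite ler_pM2r ?invr_gt0// lerB.
move: (rc _ _ (unit_itv _ sI) (unit_itv _ tI) st') => /=.
move: ((s - _) / _) ((t - _) / _) => p q.
by congr (_ / _ <= _ / _); rewrite /rcsfif_num; ring.
Qed.
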